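(* Let $K$ be a link of Conway's normal form $C(m)$ with $m\ge 0$, or $C(m,n)$ with $mn>0$, and let $D$ be a trigonal diagram of $K$. Then it is possible to transform $D$ into an alternating trigonal diagram by an isotopy of diagrams such that all intermediate diagrams remain trigonal and the number of crossings never increases.
   Context: Trigonal diagrams. For a finite (possibly empty) sequence of integers $m_1,\dots,m_k$ (zero allowed), $D(m_1,\dots,m_k)$ is the following diagram of a long link (Conway's open form, also called trigonal form). Take three horizontal strand positions $1,2,3$ across a vertical strip in the plane. At the left, position $1$ runs to infinity and positions $2,3$ are joined by a cap. Reading from left to right one inserts successively $|m_1|$ half-twists (crossings) on positions $1,2$, then $|m_2|$ half-twists on positions $2,3$, then $|m_3|$ on positions $1,2$, and so on, alternately. At the right, if $k$ is odd, position $1$ runs to infinity and positions $2,3$ are joined by a cap; if $k$ is even, position $3$ runs to infinity and positions $1,2$ are joined by a cap. Sign convention: for $i$ odd, $m_i>0$ means right-handed half-twists; for $i$ even, $m_i>0$ means left-handed half-twists. Thus a diagram whose $m_i$ all have the same sign is alternating. (Positions $1,2,3$ may be numbered from top to bottom or from bottom to top; the two resulting diagrams $D,\widetilde D$ are exchanged by a half-turn of space about the horizontal axis and carry the same Conway notation.) Joining the two infinite ends gives an (unoriented) two-bridge link in the usual sense. A trigonal diagram is a diagram of this form. Conway's normal form. A link is of Conway's normal form $C(m_1,\dots,m_k)$, where the $m_i$ all have the same sign, if it admits the (alternating) diagram $D(m_1,\dots,m_k)$; in particular $C(0)$ is the link with the crossingless diagram $D(0)$. Isotopies. An isotopy of diagrams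 here is a finite sequence of planar isotopies and Reidemeister moves. The conclusion requires that all diagrams occurring in this sequence are trigonal (planar isotopies being through diagrams of this three-strand type) and that the number of crossings is non-increasing along the sequence. *)

(* Defs.v *)
From mathcomp Require Import all_boot all_order all_algebra.
From Stdlib Require Import Relations.

Set Implicit Arguments.
Unset Strict Implicit.
Unset Printing Implicit Defensive.
Import Order.TTheory GRing.Theory Num.Theory.

(* Plane diagrams of unoriented tangles are given by Morse words: a diagram is
   cut into vertical slices, read from left to right, each containing a single
   elementary piece.  The strands crossing a vertical line are numbered from
   top to bottom, starting at 0, and [(k, i)] is the piece [k] acting on the
   strands [i] and [i.+1] (created by [Open], consumed by [Close]). *)
Inductive kind :=
  | Open               (* a new arc, opening to the right *)
  | Close              (* an arc joining two adjacent strands *)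
  | Cross of bool.     (* a half-twist; [true] means right-handed *)

Definition piece : Type := kind * nat.
Definition diagram := seq piece.

Definition incoming (k : kind) := if k is Open then 0 else 2.
Definition outgoing (k : kind) := if k is Close then 0 else 2.

Fixpoint strands (n : nat) (d : diagram) : option nat :=
  if d is (k, i) :: d' then
    if i + incoming k <= n then strands (n - incoming k + outgoing k) d'
    else None
  else Some n.

Definition closed_diagram (d : diagram) := strands 0 d = Some 0.

Definition is_crossing (p : piece) := if p.1 is Cross _ then true else false.
Definition crossings (d : diagram) := count is_crossing d.

(* The elementary moves below, applied inside a diagram, generate planar
   isotopy and isotopy of tangle diagrams (Freyd-Yetter, Turaev). *)
Inductive planar : diagram -> diagram -> Prop :=
  | planar_far a b i j :
      planar [:: (a, i); (b, i + outgoing a + j)]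
             [:: (b, i + incoming a + j); (a, i)]
  | planar_zigzag_down i : planar [:: (Open, i); (Close, i.+1)] [::]
  | planar_zigzag_up i : planar [:: (Open, i.+1); (Close, i)] [::]
  (* Rotating a crossing past the extremum of an arc turns a right-handed
     horizontal half-twist into a left-handed one. *)
  | planar_slide_open i h :
      planar [:: (Open, i.+1); (Cross h, i)] [:: (Open, i); (Cross (~~ h), i.+1)]
  | planar_slide_close i h :
      planar [:: (Cross h, i); (Close, i.+1)]
             [:: (Cross (~~ h), i.+1); (Close, i)].

Inductive reidemeister : diagram -> diagram -> Prop :=
  | reidemeister1_open i h :
      reidemeister [:: (Open, i); (Cross h, i)] [:: (Open, i)]
  | reidemeister1_close i h :
      reidemeister [:: (Cross h, i); (Close, i)] [:: (Close, i)]
  | reidemeister2 i h :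
      reidemeister [:: (Cross h, i); (Cross (~~ h), i)] [::]
  (* The side condition says that the triangle is not alternating, i.e. that
     one of the three strands passes over, or under, the two others. *)
  | reidemeister3 i a b c : (b == a) || (b == c) ->
      reidemeister [:: (Cross a, i); (Cross b, i.+1); (Cross c, i)]
                   [:: (Cross c, i.+1); (Cross b, i); (Cross a, i.+1)].

Definition move (d e : diagram) : Prop :=
  exists u v x y : diagram,
    [/\ d = u ++ x ++ v, e = u ++ y ++ v &
        planar x y \/ planar y x \/ reidemeister x y \/ reidemeister y x].

(* Two closed diagrams represent the same link. *)
Definition same_link : diagram -> diagram -> Prop :=
  clos_refl_trans diagram
    (fun d e => [/\ closed_diagram d, closed_diagram e & move d e]).

(* Travelling along a strand.  A traveller entering the slice [p] on the
   strand [j], rightwards iff [r], leaves it on the strand and in the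
   direction given by [traverse p r j]. *)
Definition traverse (p : piece) (r : bool) (j : nat) : nat * bool :=
  let: (k, i) := p in
  let a := if r then incoming k else outgoing k in
  let b := if r then outgoing k else incoming k in
  if j < i then (j, r)
  else if i + a <= j then (j - a + b, r)
  else (i + i.+1 - j, if is_crossing p then r else ~~ r).

(* In a right-handed half-twist, the strand descending from left to right is
   the over-strand. *)
Definition passes_over (p : piece) (r : bool) (j : nat) : seq bool :=
  if p is (Cross h, i) then
    if j == i then [:: r == h] else if j == i.+1 then [:: r != h] else [::]
  else [::].

(* The overpasses ([true]) and underpasses ([false]) met during the first [n]
   slices of a travel; the diagram is [catrev past future], and the traveller
   stands between [past] and [future]. *)
Fixpoint passages (n : nat) (past future : diagram) (r : bool) (j : nat) :
    seq bool :=
  if n is n'.+1 then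
    if (if r then future else past) is p :: rest then
      let: (j', r') := traverse p r j in
      passes_over p r j ++
        if r' == r then
          if r then passages n' (p :: past) rest r j'
          else passages n' rest (p :: future) r j'
        else passages n' past future r' j'
    else [::]
  else [::].

Definition alternating (d : diagram) : Prop :=
  forall (past future : diagram), d = catrev past future ->
  forall (n : nat) (r : bool) (j : nat),
    sorted (fun x y : bool => x != y) (passages n past future r j).

(* In [Dtrig b m], the strand positions 1, 2, 3 of Conway's open form are
   numbered from top to bottom if [b = false], from bottom to top if
   [b = true].  The long strand is strand 0 at both ends. *)
Definition pos12 (b : bool) : nat := if b then 1 else 0.
Definition pos23 (b : bool) : nat := if b then 0 else 1.

Fixpoint half_twists (b odd_rank : bool) (m : seq int) : diagram :=
  if m is x :: m' then
    nseq `|x|%N (if odd_rank then (Cross (0 < x)%R, pos12 b)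
                 else (Cross (x < 0)%R, pos23 b))
      ++ half_twists b (~~ odd_rank) m'
  else [::].

Definition Dtrig (b : bool) (m : seq int) : diagram :=
  (Open, pos23 b) :: half_twists b true m
    ++ [:: (Close, if odd (size m) then pos23 b else pos12 b)].

Definition trigonal (d : diagram) : Prop := exists b m, d = Dtrig b m.

(* Joining the two infinite ends of a long diagram by an arc passing below. *)
Definition join_ends (d : diagram) : diagram :=
  (Open, 0) :: d ++ [:: (Close, 0)].

Definition same_sign (m : seq int) : bool :=
  all (fun x : int => 0 <= x)%R m || all (fun x : int => x <= 0)%R m.

Definition conway_normal_form (K : diagram) (m : seq int) : Prop :=
  same_sign m /\ exists b, same_link (join_ends (Dtrig b m)) K.

Definition trigonal_diagram_of (K d : diagram) : Prop :=
  trigonal d /\ same_link (join_ends d) K.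

Definition trigonal_isotopy : diagram -> diagram -> Prop :=
  clos_refl_trans diagram
    (fun d e => [/\ trigonal d, trigonal e, move d e &
                    crossings e <= crossings d]).

(* Main.v *)
Require Import Defs.
From mathcomp Require Import all_boot all_order all_algebra.
From Stdlib Require Import Relations Classical FunctionalExtensionality.
From mathcomp Require Import zify ring.

(** A trigonal diagram is a cap, a word in the generators of the braid group on
    three strands and their inverses, and another cap.  Every trigonal isotopy
    used here rewrites such a word: a braid relation, a cancellation, a kink
    removed at a cap, or a crossing slid past a cap, which moves the cap to the
    other two strands.  A generator has a Conway sign, its handedness corrected
    by its position; a word whose letters have the same Conway sign gives an
    alternating diagram ([unisigned_alternating]).

    Rewrite the given diagram until it cannot be shortened any more.  Two
    adjacent letters [s] and [t] of opposite Conway signs are then generators of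
    the same handedness on different strands, and the word cannot contain
    [s t s], since this half-turn travels to the left cap and disappears there
    ([shrinks_half_turn]).  Similarly a first sign change too close to the left
    cap can be pushed into it ([irreducible_left]), and symmetrically on the
    right ([irreducible_right]).

    What remains is to see that an irreducible word with a sign change cannot
    represent [C(m)] or [C(m, n)], and this is done with the Kauffman bracket.
    On diagrams with the left cap the bracket takes values in the span of the
    two planar diagrams, so that crossings act by [2 x 2] matrices.  In this
    representation [s t] equals, up to a unit, the inverse of [t] followed by the
    half-turn, and the half-turn exchanges the two basis vectors.  Hence each
    sign change may be replaced by a single letter, which produces an alternating
    word with the same bracket ([irreducible_straighten]).  The constraints near
    the caps say that the interior of that word, meaning the word without its
    first and last letters, has at least three blocks of equal letters.

    For an alternating word the matrices become, up to units, those of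
    [q]-deformed continued fractions with [q = - A ^ (-4)].  The bracket is then
    a unit times a polynomial with constant coefficient 1, whose coefficient at
    [q] is the number of interior blocks of one of the two letters
    ([interior_poly4]); replacing [A] by its inverse exchanges the letters.  For
    [C(m)] and [C(m, n)] the interior has at most two blocks, so the coefficient
    is at most 1 for either choice.  For an irreducible word with a sign change
    it is at least 2 for one of the choices. *)

Set Implicit Arguments.
Unset Strict Implicit.
Unset Printing Implicit Defensive.
Import Order.TTheory GRing.Theory Num.Theory.

(** * Trigonal diagrams as words *)

(** The half-twist of handedness [l.1] on the strands [l.2] and [l.2 + 1]: a
    generator of the braid group on three strands, or its inverse. *)
Definition letter : Type := bool * bool.
Definition word := seq letter.

Definition crossing_piece (l : letter) : piece := (Cross l.1, nat_of_bool l.2).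

(** The two ways of opening a diagram at the left, and of closing it at the
    right, are independent of the word: zero entries in the Conway sequence
    make all combinations occur, see [trigonalP]. *)
Definition trig (i : bool) (w : word) (j : bool) : diagram :=
  (Open, nat_of_bool i) :: map crossing_piece w ++ [:: (Close, nat_of_bool j)].

Lemma half_twists_word b o m :
  exists w, half_twists b o m = map crossing_piece w.
Proof.
elim: m o => [|x m IH] o /=; first by exists [::].
have [w ->] := IH (~~ o).
exists (nseq `|x|%N (if o then ((0 < x)%R, b) else ((x < 0)%R, ~~ b)) ++ w).
by rewrite map_cat map_nseq; case: o; case: b {IH}.
Qed.

(** A zero entry changes the parity of the rank without adding a crossing; this
    makes the parity [p] of the length free, hence also the right cap. *)
Lemma word_half_twists b o p (w : word) :
  exists2 m, half_twists b o m = map crossing_piece w & odd (size m) = p.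
Proof.
elim: w o p => [|[h k] w IH] o p.
  by case: p; [exists [:: 0%R] | exists [::]].
have step o' p' : k = (o' == b) -> exists2 m,
    half_twists b o' m = map crossing_piece ((h, k) :: w) & odd (size m) = p'.
  move=> ->; have [m Em pm] := IH (~~ o') (~~ p').
  exists ((if h == o' then 1 else -1)%R :: m); last by rewrite /= pm negbK.
  by rewrite /= Em; case: h; case: o' {Em}; case: b {IH}.
have [/step //|ne] := eqVneq k (o == b).
have [|m Em pm] := step (~~ o) (~~ p); first by move: ne; clear; case: k o b => [] [] [].
by exists (0%R :: m); rewrite /= ?Em // pm negbK.
Qed.

Lemma trigonalP d : trigonal d <-> exists i w j, d = trig i w j.
Proof.
split=> [[b [m ->]]|[i [w [j ->]]]].
  have [w Ew] := half_twists_word b true m.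
  exists (~~ b), w, (odd (size m) (+) b); rewrite /trig /Dtrig Ew.
  by case: b (odd _) {Ew} => [] [].
have [m Em pm] := word_half_twists (~~ i) true (j == i) w.
exists (~~ i), m; rewrite /Dtrig Em pm /trig.
by case: i j {Em pm} => [] [].
Qed.

Lemma crossings_trig i w j : crossings (trig i w j) = size w.
Proof.
rewrite /crossings /trig /= count_cat /= !addn0 add0n count_map.
by rewrite (eq_count (a2 := predT)) ?count_predT.
Qed.

(** The isotopies between trigonal diagrams that do not create crossings.  The
    slides past a cap are oriented both ways, since [i] and [j] are arbitrary,
    and so are the braid relations, as [k] is. *)
Inductive step : bool -> word -> bool -> bool -> word -> bool -> Prop :=
  | step_kink_open i h w j : step i ((h, i) :: w) j i w j
  | step_kink_close i h w j : step i (rcons w (h, j)) j i w j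
  | step_cancel i u h k v j :
      step i (u ++ (h, k) :: (~~ h, k) :: v) j i (u ++ v) j
  | step_braid i u a b c k v j : (b == a) || (b == c) ->
      step i (u ++ (a, k) :: (b, ~~ k) :: (c, k) :: v) j
           i (u ++ (c, ~~ k) :: (b, k) :: (a, ~~ k) :: v) j
  | step_slide_open i h w j :
      step i ((h, ~~ i) :: w) j (~~ i) ((~~ h, i) :: w) j
  | step_slide_close i h w j :
      step i (rcons w (h, ~~ j)) j i (rcons w (~~ h, j)) (~~ j).

Inductive red (i : bool) (w : word) (j : bool) : bool -> word -> bool -> Prop :=
  | red_refl : red i w j i w j
  | red_step i1 w1 j1 i2 w2 j2 :
      step i w j i1 w1 j1 -> red i1 w1 j1 i2 w2 j2 -> red i w j i2 w2 j2.

Lemma red_trans i w j i1 w1 j1 i2 w2 j2 :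
  red i w j i1 w1 j1 -> red i1 w1 j1 i2 w2 j2 -> red i w j i2 w2 j2.
Proof. by elim=> // {}i {}w {}j *; apply: red_step; eauto. Qed.

Lemma red1 i w j i1 w1 j1 : step i w j i1 w1 j1 -> red i w j i1 w1 j1.
Proof. by move=> /red_step; apply; apply: red_refl. Qed.

(** Reflection in a vertical line: facts about the left cap transfer to the
    right one. *)
Lemma step_rev i w j i1 w1 j1 :
  step i w j i1 w1 j1 -> step j (rev w) i j1 (rev w1) i1.
Proof.
case=> {i w j i1 w1 j1} => [i h w j|i h w j|i u h k v j|i u a b c k v j E|i h w j|i h w j];
  rewrite ?rev_cat ?rev_rcons ?rev_cons -?cats1 -?catA /=.
- by rewrite cats1; apply: step_kink_close.
- exact: step_kink_open.
- by have := step_cancel j (rev v) (~~ h) k (rev u) i; rewrite negbK.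
- by apply: step_braid; rewrite orbC.
- by rewrite !cats1; apply: step_slide_close.
- exact: step_slide_open.
Qed.

Lemma red_rev i w j i1 w1 j1 :
  red i w j i1 w1 j1 -> red j (rev w) i j1 (rev w1) i1.
Proof.
elim=> [{}i {}w {}j|{}i {}w {}j i2 w2 j2 i3 w3 j3 /step_rev s _ IH].
  exact: red_refl.
exact: red_step s IH.
Qed.

Lemma move_in u v x y :
  planar x y \/ planar y x \/ reidemeister x y \/ reidemeister y x ->
  move (u ++ x ++ v) (u ++ y ++ v).
Proof. by exists u, v, x, y. Qed.

Lemma step_move i w j i1 w1 j1 :
  step i w j i1 w1 j1 -> move (trig i w j) (trig i1 w1 j1).
Proof.
case=> {i w j i1 w1 j1} => [i h w j|i h w j|i u h k v j|i u a b c k v j E|i h w j|i h w j];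
  rewrite /trig ?map_cat ?map_rcons /= -?cats1 -?catA /=.
- apply: (@move_in [::] _ [:: _; _] [:: _]).
  by right; right; left; apply: reidemeister1_open.
- rewrite -!cat_cons; apply: (@move_in (_ :: _) [::] [:: _; _] [:: _]).
  by right; right; left; apply: reidemeister1_close.
- rewrite -!cat_cons; apply: (@move_in (_ :: _) _ [:: _; _] [::]).
  by right; right; left; apply: reidemeister2.
- rewrite -!cat_cons; apply: (@move_in (_ :: _) _ [:: _; _; _] [:: _; _; _]).
  right; right; case: k => /=; [right|left]; last exact: reidemeister3.
  by apply: reidemeister3; rewrite orbC.
- apply: (@move_in [::] _ [:: _; _] [:: _; _]).
  case: i => /=; [left|right; left]; first exact: planar_slide_open.
  by rewrite -{2}(negbK h); apply: planar_slide_open.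
- rewrite -!cat_cons; apply: (@move_in (_ :: _) [::] [:: _; _] [:: _; _]).
  case: j => /=; [left|right; left]; first exact: planar_slide_close.
  by rewrite -{2}(negbK h); apply: planar_slide_close.
Qed.

Lemma step_size i w j i1 w1 j1 : step i w j i1 w1 j1 -> size w1 <= size w.
Proof. by case=> *; rewrite ?size_cat ?size_rcons /= ?size_cat //=; lia. Qed.

Lemma red_isotopy i w j i1 w1 j1 :
  red i w j i1 w1 j1 -> trigonal_isotopy (trig i w j) (trig i1 w1 j1).
Proof.
elim=> [*|{}i {}w {}j i2 w2 j2 i3 w3 j3 s _ IH]; first exact: rt_refl.
apply: rt_trans IH; apply: rt_step; split.
- by apply/trigonalP; exists i, w, j.
- by apply/trigonalP; exists i2, w2, j2.
- exact: step_move.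
- by rewrite !crossings_trig; apply: step_size s.
Qed.

(** * Irreducible words *)

Definition shrinks i w j :=
  exists i1 w1 j1, red i w j i1 w1 j1 /\ size w1 < size w.

Lemma shrinks_rev i w j : shrinks i w j -> shrinks j (rev w) i.
Proof.
move=> [i1 [w1 [j1 [/red_rev r s]]]]; exists j1, (rev w1), i1.
by move: r s; rewrite !size_rev.
Qed.

Lemma red_size i w j i1 w1 j1 : red i w j i1 w1 j1 -> size w1 <= size w.
Proof.
elim=> // {}i {}w {}j i2 w2 j2 i3 w3 j3 /step_size s _; lia.
Qed.

Lemma red_shrinks i w j i1 w1 j1 :
  red i w j i1 w1 j1 -> shrinks i1 w1 j1 -> shrinks i w j.
Proof.
move=> r [i2 [w2 [j2 [r2 s2]]]]; exists i2, w2, j2.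
by split; [apply: red_trans r2|have := red_size r; lia].
Qed.

Lemma step_shrinks i w j i1 w1 j1 :
  step i w j i1 w1 j1 -> shrinks i1 w1 j1 -> shrinks i w j.
Proof. by move=> /red1; apply: red_shrinks. Qed.

Lemma shrinks1 i w j i1 w1 j1 :
  step i w j i1 w1 j1 -> size w1 < size w -> shrinks i w j.
Proof. by move=> s lt; exists i1, w1, j1; split=> //; apply: red1. Qed.

Lemma shrinks_kink i h w j : shrinks i ((h, i) :: w) j.
Proof. by apply: shrinks1 (step_kink_open _ _ _ _) _ => /=. Qed.

Lemma shrinks_cancel i u h k v j : shrinks i (u ++ (h, k) :: (~~ h, k) :: v) j.
Proof. by apply: shrinks1 (step_cancel _ _ _ _ _ _) _; rewrite !size_cat /=; lia. Qed.

(** A half-turn commutes with the letters on its left up to exchanging the two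
    generators.  So it moves left without changing the length of the word,
    until it cancels a letter or is absorbed by the cap. *)
Lemma shrinks_half_turn i u h k v j :
  shrinks i (u ++ (h, k) :: (h, ~~ k) :: (h, k) :: v) j.
Proof.
have braid u' k' v' : step i (u' ++ (h, k') :: (h, ~~ k') :: (h, k') :: v') j
    i (u' ++ (h, ~~ k') :: (h, k') :: (h, ~~ k') :: v') j.
  by apply: step_braid; rewrite eqxx.
elim/last_ind: u k v => [|u [g k1] IH] k v.
  have [->|ki] := eqVneq k i; first exact: shrinks_kink.
  apply: step_shrinks (braid [::] k v) _.
  by have -> : ~~ k = i by [move: ki; clear; case: k i => [] []]; apply: shrinks_kink.
rewrite -cats1 -catA /=.
have [->|gh] := eqVneq g h; last first.
  have -> : h = ~~ g by move: gh; clear; case: g h => [] [].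
  have [->|ne] := eqVneq k1 k; first exact: shrinks_cancel.
  rewrite -cat_rcons; apply: step_shrinks.
    by apply: step_braid; rewrite eqxx.
  rewrite cat_rcons.
  by have -> : ~~ k = k1 by [move: ne; clear; case: k k1 => [] []]; apply: shrinks_cancel.
have [->|ne] := eqVneq k1 k.
  rewrite -cat_rcons; apply: step_shrinks (braid _ _ _) _.
  by rewrite cat_rcons; apply: IH.
have -> : k = ~~ k1 by move: ne; clear; case: k k1 => [] [].
rewrite negbK; exact: IH.
Qed.

(** Among the two letters of Conway sign opposite to that of [l], [swapped l] is
    the one that does not cancel [l]: a sign change in a word without
    cancellation is always of the form [l :: swapped l].  [partner l] is the
    other letter of the Conway sign of [l]. *)
Definition swapped (l : letter) : letter := (l.1, ~~ l.2).
Definition partner (l : letter) : letter := (~~ l.1, ~~ l.2).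
Definition inverse (l : letter) : letter := (~~ l.1, l.2).
(** Conway's sign. *)
Definition csign (l : letter) := l.1 (+) l.2.

(** Conjugating [swapped s] by [s]: the relation [T s t = s t S], read with [T]
    the inverse of [t] and [S] the inverse of [s], needs no extra crossing
    because [s] stands alone between [T] and [t]. *)
Lemma red_push i u c s v j :
  red i (u ++ nseq c (partner s) ++ s :: swapped s :: v) j
      i (u ++ s :: swapped s :: nseq c (inverse s) ++ v) j.
Proof.
case: s => h k; rewrite /partner /swapped /inverse /=.
elim: c v => [|c IH] v; first exact: red_refl.
rewrite -[in nseq _ _]addn1 nseqD -!catA /= [in X in red _ X]catA.
apply: red_step.
  have := @step_braid i (u ++ nseq c (~~ h, ~~ k)) (~~ h) h h (~~ k) v j.
  by rewrite !negbK eqxx orbT => /(_ isT); apply.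
rewrite -catA; apply: red_trans (IH _) _.
have -> : nseq c (~~ h, k) ++ (~~ h, k) :: v = nseq c.+1 (~~ h, k) ++ v.
  by rewrite -[in RHS]addn1 nseqD -catA.
exact: red_refl.
Qed.

(** Once [s t] is pushed to the cap, either [s] is a kink there, or it slides
    past the cap, becomes the inverse of [t] and cancels [t]. *)
Lemma shrinks_left i c s v j :
  shrinks i (nseq c (partner s) ++ s :: swapped s :: v) j.
Proof.
apply: red_shrinks (red_push i [::] c s v j) _ => /=.
case: s => h k; rewrite /partner /swapped /inverse /=.
have [->|ki] := eqVneq k i; first exact: shrinks_kink.
have {ki} -> : k = ~~ i by move: ki; clear; case: k i => [] [].
apply: step_shrinks (step_slide_open _ _ _ _) _; rewrite negbK.
by have := @shrinks_cancel (~~ i) [::] (~~ h) i (nseq c (~~ h, ~~ i) ++ v) j; rewrite negbK.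
Qed.

(** The remaining left end from which a sign change reaches the cap: with two
    copies of [s] at the cap, the first one slides into [T], and [T s t] gives
    [s t S], whose first letter is a kink. *)
Lemma shrinks_left' i c s v j :
  shrinks i (s :: nseq c (partner s) ++ s :: swapped s :: v) j.
Proof.
apply: red_shrinks (red_push i [:: s] c s v j) _ => /=.
case: s => h k; rewrite /partner /swapped /inverse /=.
have [->|ki] := eqVneq k i; first exact: shrinks_kink.
have {ki} -> : k = ~~ i by move: ki; clear; case: k i => [] [].
apply: step_shrinks (step_slide_open _ _ _ _) _.
have := red_push (~~ i) [::] 1 (h, ~~ i) (nseq c (~~ h, ~~ i) ++ v) j.
rewrite /partner /swapped /inverse /= negbK => r.
by apply: red_shrinks r _; apply: shrinks_kink.
Qed.

Definition irreducible i w j := ~ shrinks i w j.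

Lemma red_irreducible i w j :
  exists i1 w1 j1, red i w j i1 w1 j1 /\ irreducible i1 w1 j1.
Proof.
move: {2}(size w).+1 (ltnSn (size w)) => n.
elim: n => // n IH in i w j * => lt_n.
have [[i1 [w1 [j1 [r1 lt1]]]]|irr] := classic (shrinks i w j); last first.
  by exists i, w, j; split=> //; apply: red_refl.
have [|i2 [w2 [j2 [r2 irr2]]]] := IH i1 w1 j1; first lia.
by exists i2, w2, j2; split=> //; apply: red_trans r2.
Qed.

Definition unisigned e (w : word) := all (fun l => csign l == e) w.

Lemma unisigned_letter e l s :
  csign l = e -> csign s = e -> (l == s) || (l == partner s).
Proof. by case: e l s => [] [[] []] [[] []]. Qed.

(** All letters before the sign change are [s] or [partner s].  If [s] were not
    among those after the first letter, the word would start as in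
    [shrinks_left] or [shrinks_left']. *)
Lemma irreducible_left i j X s Z e :
  irreducible i (X ++ s :: swapped s :: Z) j -> unisigned e (rcons X s) ->
  exists x X0, X = x :: X0 /\ s \in X0.
Proof.
rewrite /unisigned all_rcons => irr /andP[/eqP es /allP eX].
have partners Y : {subset Y <= X} -> s \notin Y -> Y = nseq (size Y) (partner s).
  move=> sub sY; apply/all_pred1P/allP => y yY /=.
  case/orP: (unisigned_letter (eqP (eX _ (sub _ yY))) es) => // /eqP ys.
  by rewrite -ys yY in sY.
case: X => [|x X0] in irr eX partners *.
  by case: irr; apply: (shrinks_left i 0).
have [|sX0] := boolP (s \in X0); first by exists x, X0.
case: irr.
have E0 : X0 = nseq (size X0) (partner s).
  by apply: partners => // y yX; rewrite inE yX orbT.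
case/orP: (unisigned_letter (eqP (eX x (mem_head _ _))) es) => /eqP->; rewrite E0.
  exact: shrinks_left'.
exact: (shrinks_left i (size X0).+1).
Qed.

Lemma irreducible_right i j X s Z e :
  irreducible i (X ++ s :: swapped s :: Z) j -> unisigned e (swapped s :: Z) ->
  exists Z0 z, Z = rcons Z0 z /\ swapped s \in Z0.
Proof.
move=> irr eZ.
have [||z [Z0 [EZ tZ]]] := @irreducible_left j i (rev Z) (swapped s) (rev X) e.
- move=> /shrinks_rev H; apply: irr; move: H.
  rewrite rev_cat !rev_cons !revK -!cats1 -!catA /=.
  by case: s {eZ} => h k; rewrite /swapped /= negbK.
- by rewrite -rev_cons /unisigned all_rev.
exists (rev Z0), z; rewrite mem_rev; split=> //.
by rewrite -[Z]revK EZ rev_cons.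
Qed.

Definition tight (w : word) :=
  (forall u l v, w <> u ++ l :: inverse l :: v) /\
  (forall u s v, w <> u ++ s :: swapped s :: s :: v).

Lemma irreducible_tight i w j : irreducible i w j -> tight w.
Proof.
move=> irr; split=> u [h k] v Ew; case: irr; rewrite Ew.
  exact: shrinks_cancel.
exact: shrinks_half_turn.
Qed.

Lemma irreducible_head i l w j : irreducible i (l :: w) j -> l.2 = ~~ i.
Proof.
case: l => h k irr; have [E|] := eqVneq k i; last by case: k i {irr} => [] [].
by case: irr; rewrite E; apply: shrinks_kink.
Qed.

Lemma irreducible_last i l w j : irreducible i (rcons w l) j -> l.2 = ~~ j.
Proof.
move=> irr; apply: (@irreducible_head _ l (rev w) i) => /shrinks_rev.
by rewrite rev_cons revK.
Qed.


(** * Alternating diagrams *)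

(** In a diagram where this holds, the over-strand of every crossing is
    determined by the parity of the strand on which one enters and by the
    direction of travel; see [next_pass]. *)
Definition checkered (e : bool) (p : piece) :=
  if p.1 is Cross h then h (+) odd p.2 == e else true.

Definition next_pass (e r : bool) (j : nat) : bool := ~~ (r (+) odd j (+) e).

Definition alternates_from (b : bool) (s : seq bool) :=
  if s is x :: s' then (x == b) && path (fun x y : bool => x != y) x s' else true.

Lemma alternates_from_cons b s :
  alternates_from (~~ b) s -> alternates_from b (b :: s).
Proof. by case: s => [|x s] /=; rewrite eqxx //= => /andP[/eqP-> ->]; case: b. Qed.

Lemma odd_reflect i j : i <= j -> j < i + 2 -> odd (i + i.+1 - j) = ~~ odd j.
Proof.
move=> ij ji; rewrite oddB; last lia.
by rewrite oddD /= addbN addbb.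
Qed.

Lemma odd_shift a b j : a <= j -> odd a = odd b -> odd (j - a + b) = odd j.
Proof. by move=> aj ab; rewrite oddD oddB // ab -addbA addbb addbF. Qed.

(** Entering a crossing changes the parity of the strand but not the direction;
    turning at an extremum changes both.  So the predicted pass changes exactly
    at crossings. *)
Lemma traverse_passes e p r j : checkered e p ->
  let: (j', r') := traverse p r j in
  if passes_over p r j is [::] then next_pass e r' j' = next_pass e r j
  else passes_over p r j = [:: next_pass e r j] /\
       next_pass e r' j' = ~~ next_pass e r j.
Proof.
case: p => k i; rewrite /checkered /next_pass /traverse.
set a := (if r then _ else _); set b := (if r then _ else _).
have ab : odd a = odd b by rewrite /a /b; clear; case: k (r) => [||h] [].
have a2 : a <= 2 by rewrite /a; clear; case: k (r) => [||h] [].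
case: ltnP => [ji|ij] /=.
  case: k {ab a2 a b} => // h _.
  by rewrite !ifN ?neq_ltn ?ji ?ltnS ?(ltnW ji).
case: leqP => [aj|ja].
  rewrite odd_shift //; last by apply: leq_trans aj; apply: leq_addl.
  move: aj; rewrite /a; clear; case: k => // h; rewrite if_same => aj _.
  rewrite /= in aj; have /negPf-> : j != i by apply/eqP; lia.
  by have /negPf-> : j != i.+1 by apply/eqP; lia.
rewrite odd_reflect //; last by apply: leq_trans ja _; rewrite leq_add2l.
move: ij ja; rewrite /a; clear; case: k => [||h] /= ij ja; rewrite /is_crossing /=.
- by case: (r) (odd j) (e) => [] [] [].
- by case: (r) (odd j) (e) => [] [] [].
rewrite if_same in ja; move/eqP=> <-.
have [->|ne] := eqVneq j i; first by clear ij ja; case: r h (odd i) => [] [] [].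
have -> : j = i.+1 by rewrite /= in ja; move/eqP: ne; lia.
by rewrite eqxx /=; clear; case: r h (odd i) => [] [] [].
Qed.

Lemma passages_alternate e n past future r j :
  all (checkered e) past -> all (checkered e) future ->
  alternates_from (next_pass e r j) (passages n past future r j).
Proof.
elim: n => //= n IH in past future r j *.
set rest := if r then future else past.
case Er: rest => [//|p rest'] cp cf; subst rest.
have [cpp cr] : checkered e p /\ all (checkered e) rest'.
  by case: r Er cp cf => -> /=; [move=> _|] => /andP[].
have := traverse_passes r j cpp; case: (traverse p r j) => [j' r'].
have : alternates_from (next_pass e r' j')
    (if r' == r then
       if r then passages n (p :: past) rest' r j'
       else passages n rest' (p :: future) r j'
     else passages n past future r' j').
  case: eqP => [->|_]; last exact: IH.
  by case: (r); apply: IH => //=; rewrite cpp.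
case: passes_over => [|x s] next; first by move<-.
by case=> -> E; apply: alternates_from_cons; rewrite -E.
Qed.

Lemma checkered_alternating e d : all (checkered e) d -> alternating d.
Proof.
move=> cd past future Ed n r j.
move: cd; rewrite Ed catrevE all_cat all_rev => /andP[cp cf].
have := passages_alternate n r j cp cf.
by case: passages => //= x s /andP[_].
Qed.

Lemma unisigned_alternating e i w j : unisigned e w -> alternating (trig i w j).
Proof.
move=> ew; apply: (@checkered_alternating e).
rewrite /trig /= all_cat /= andbT all_map; apply: sub_all ew => l /=.
by rewrite /checkered /csign /= oddb.
Qed.

(** * The Kauffman bracket *)

(** The bracket is an invariant of unoriented links only up to these factors,
    which come from kinks. *)
Definition signed_power (F : fieldType) (t c : F) :=
  exists (b : bool) (k : int), c = ((-1) ^+ b * t ^ k)%R.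

Section SignedPower.
Local Open Scope ring_scope.
Variables (F : fieldType) (t : F).
Hypothesis t0 : t != 0.

Lemma signed_power1 : signed_power t 1.
Proof. by exists false, 0; rewrite mulr1. Qed.

Lemma signed_powerX k : signed_power t (t ^ k).
Proof. by exists false, k; rewrite mul1r. Qed.

Lemma signed_powerN x : signed_power t x -> signed_power t (- x).
Proof.
move=> [b [k ->]]; exists (~~ b), k.
by case: b; rewrite /= ?expr1 ?expr0 ?mulN1r ?mul1r ?opprK.
Qed.

Lemma signed_powerM x y :
  signed_power t x -> signed_power t y -> signed_power t (x * y).
Proof.
move=> [b [k ->]] [c [l ->]]; exists (b (+) c), (k + l).
by rewrite expfzDr // mulrACA signr_addb.
Qed.

Lemma signed_powerV x : signed_power t x -> signed_power t x^-1.
Proof.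
move=> [b [k ->]]; exists b, (- k).
by rewrite invfM invr_expz; case: b; rewrite /= ?expr1 ?invrN1 ?expr0 ?invr1.
Qed.

Lemma signed_power_inv x : signed_power t^-1 x -> signed_power t x.
Proof. by move=> [b [k ->]]; exists b, (- k); rewrite exprz_inv. Qed.

Lemma signed_power_neq0 x : signed_power t x -> x != 0.
Proof.
by move=> [b [k ->]]; rewrite mulf_neq0 ?expfz_neq0 // signr_eq0.
Qed.

End SignedPower.

Section Bracket.
Local Open Scope ring_scope.
Variables (F : fieldType) (A : F).
Hypothesis A0 : A != 0.

(** The functions on binary words of length [n] form the [n]-th tensor power of
    a plane, and a diagram maps the tensor power given by its left ends to the
    one given by its right ends.  The two arcs act by pairings chosen to satisfy
    the Temperley-Lieb relations with loop value [- A ^ 2 - A ^ (-2)]. *)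
Definition state := seq bool -> F.

Definition weight (h : bool) : F := if h then A else A^-1.

Definition cup (a b : bool) : F := if a == b then 0 else if b then A else - A^-1.

Definition close_op (phi : state) : state := fun w =>
  - A * phi (false :: true :: w) + A^-1 * phi (true :: false :: w).

Definition local_op (k : kind) (phi : state) : state := fun w =>
  match k, w with
  | Open, a :: b :: w' => cup a b * phi w'
  | Close, _ => close_op phi w
  | Cross h, a :: b :: w' =>
      weight h * phi w + weight (~~ h) * (cup a b * close_op phi w')
  | _, _ => 0
  end.

Fixpoint piece_op (i : nat) (k : kind) (phi : state) : state := fun w =>
  if i is i'.+1 then
    if w is c :: w' then piece_op i' k (fun u => phi (c :: u)) w' else 0
  else local_op k phi w.

Fixpoint eval (d : diagram) (phi : state) : state :=
  if d is p :: d' then eval d' (piece_op p.2 p.1 phi) else phi.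

Lemma eval_cat d e phi : eval (d ++ e) phi = eval e (eval d phi).
Proof. by elim: d phi => //= p d IH phi. Qed.

Lemma piece_op_shift u j k phi w :
  piece_op (size u + j) k phi (u ++ w) = piece_op j k (fun v => phi (u ++ v)) w.
Proof. by elim: u phi => //= c u IH phi; rewrite addSn /= IH. Qed.

Definition shift (i : nat) (d : diagram) : diagram :=
  [seq (p.1, (i + p.2)%N) | p <- d].

Lemma eval_shift u d phi w :
  eval (shift (size u) d) phi (u ++ w) = eval d (fun v => phi (u ++ v)) w.
Proof.
elim: d phi => //= p d IH phi; rewrite IH; congr (eval d _ w).
by apply: functional_extensionality => v; rewrite piece_op_shift.
Qed.

Lemma piece_op_lin j k phi psi x y w :
  piece_op j k (fun v => x * phi v + y * psi v) w =
  x * piece_op j k phi w + y * piece_op j k psi w.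
Proof.
elim: j phi psi w => [|j IH] phi psi [|c w] //=; try by rewrite !mulr0 addr0.
  by case: k => /=; rewrite /close_op /= => *; ring.
by case: k => [||h] /=; case: w => [|d w]; rewrite /close_op /=; ring.
Qed.

Lemma piece_op_scale j k phi x w :
  piece_op j k (fun v => x * phi v) w = x * piece_op j k phi w.
Proof.
have := piece_op_lin j k phi phi x 0 w; rewrite mul0r addr0 => <-.
by congr piece_op; apply: functional_extensionality => v; rewrite mul0r addr0.
Qed.

Lemma piece_op_ext n i k phi psi x :
  (forall w, size w = n -> phi w = x * psi w) -> (i + incoming k <= n)%N ->
  forall w, size w = (n - incoming k + outgoing k)%N ->
  piece_op i k phi w = x * piece_op i k psi w.
Proof.
elim: i n phi psi => [|i IH] n phi psi E le w sw /=.
  case: k le sw => [||h] /= le sw; rewrite /close_op.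
  - by case: w sw => [|a [|b w]] /= sw; rewrite ?mulr0 // E; [ring|lia].
  - by rewrite !E /=; [ring|lia..].
  - by case: w sw => [|a [|b w]] /= sw; rewrite ?mulr0 // !E /=; [ring|lia..].
case: w sw => [|c w] /= sw; first lia.
by apply: (IH n.-1) => [v sv||]; [apply: E => /=; lia|lia..].
Qed.

Lemma eval_ext n m d phi psi x :
  (forall w, size w = n -> phi w = x * psi w) -> strands n d = Some m ->
  forall w, size w = m -> eval d phi w = x * eval d psi w.
Proof.
elim: d n phi psi => [|[k i] d IH] n phi psi E /=; first by case=> <-.
case: ifP => // le; apply: IH => w sw; exact: piece_op_ext E le w sw.
Qed.

(** Pieces on disjoint strands act on different tensor factors. *)
Lemma far_eval a b j phi w : (outgoing a <= size w)%N ->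
  eval [:: (a, 0); (b, outgoing a + j)]%N phi w =
  eval [:: (b, incoming a + j); (a, 0)]%N phi w.
Proof.
move=> le; rewrite /=; case: a le => [||h] /=.
- case: w => [|c [|d w]] //= _.
  exact: piece_op_scale.
- by move=> _; rewrite /close_op add0n piece_op_lin.
- case: w => [|c [|d w]] //= _; rewrite /close_op /=.
  have E x y z (f g k : state) v : piece_op j b
      (fun u => x * f u + y * (z * (- A * g u + A^-1 * k u))) v =
    x * piece_op j b f v + y * (z * (- A * piece_op j b g v + A^-1 * piece_op j b k v)).
    have -> : (fun u => x * f u + y * (z * (- A * g u + A^-1 * k u))) =
      (fun u => x * f u + (y * z) * (- A * g u + A^-1 * k u)).
      by apply: functional_extensionality => u; rewrite mulrA.
    by rewrite !piece_op_lin mulrA.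
  exact: E.
Qed.

Ltac strands_arith :=
  repeat match goal with H : strands _ _ = _ |- _ => move: H end;
  rewrite /=; repeat (case: ifP => //); intros;
  repeat match goal with H : Some _ = Some _ |- _ => case: H => H end; lia.

Lemma planar_strands x y n m m' :
  planar x y -> strands n x = Some m -> strands n y = Some m' -> m = m'.
Proof. by case=> *; strands_arith. Qed.

Lemma reidemeister_strands x y n m m' :
  reidemeister x y -> strands n x = Some m -> strands n y = Some m' -> m = m'.
Proof. by case=> *; strands_arith. Qed.

(** It suffices to compare the two sides of a move on the topmost strands. *)
Lemma eval_local i x0 y0 c x y phi w :
  x = shift i x0 -> y = shift i y0 -> (i <= size w)%N ->
  (forall psi v, size w = (i + size v)%N -> eval x0 psi v = c * eval y0 psi v) ->
  eval x phi w = c * eval y phi w.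
Proof.
move=> -> -> le H; rewrite -[w](cat_take_drop i).
have Ei : size (take i w) = i by rewrite size_takel.
have E d := eval_shift (take i w) d phi (drop i w).
by rewrite Ei in E; rewrite !E H // size_drop subnKC.
Qed.

(* After all bits are known, both sides are explicit linear combinations of
   values of the state. *)
Ltac crossing_sums :=
  rewrite /= /close_op /= /cup /weight /= ?mul0r ?mulr0 ?addr0 ?add0r; field; rewrite ?A0 //.

Lemma planar_eval x y n m phi w :
  planar x y -> strands n x = Some m -> size w = m -> eval x phi w = 1 * eval y phi w.
Proof.
case=> [a b i j|i|i|i h|i h] H sw.
- have le : (i + outgoing a <= size w)%N by rewrite sw; strands_arith.
  apply: (@eval_local i [:: (a, 0); (b, outgoing a + j)]%N [:: (b, incoming a + j); (a, 0)]%N).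
  + by rewrite /shift /= addn0 addnA.
  + by rewrite /shift /= addn0 addnA.
  + lia.
  + by move=> psi v sv; rewrite mul1r; apply: far_eval; lia.
- have le : (i.+1 <= size w)%N by rewrite sw; strands_arith.
  apply: (@eval_local i [:: (Open, 0); (Close, 1)]%N [::]).
  + by rewrite /shift /= addn0 addn1.
  + by [].
  + lia.
  + by move=> psi [|[] v] sv; [rewrite /= in sv; lia|crossing_sums..].
- have le : (i.+1 <= size w)%N by rewrite sw; strands_arith.
  apply: (@eval_local i [:: (Open, 1); (Close, 0)]%N [::]).
  + by rewrite /shift /= addn0 addn1.
  + by [].
  + lia.
  + by move=> psi [|[] v] sv; [rewrite /= in sv; lia|crossing_sums..].
- have le : (i.+3 <= size w)%N by rewrite sw; strands_arith.
  apply: (@eval_local i [:: (Open, 1); (Cross h, 0)]%N [:: (Open, 0); (Cross (~~ h), 1)]%N).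
  + by rewrite /shift /= addn0 addn1.
  + by rewrite /shift /= addn0 addn1.
  + lia.
  + move=> psi [|c0 [|c1 [|c2 v]]] /= sv; try lia.
    by case: h {H}; case: c0 c1 c2 {sv} => [] [] []; crossing_sums.
- have le : (i.+1 <= size w)%N by rewrite sw; strands_arith.
  apply: (@eval_local i [:: (Cross h, 0); (Close, 1)]%N [:: (Cross (~~ h), 1); (Close, 0)]%N).
  + by rewrite /shift /= addn0 addn1.
  + by rewrite /shift /= addn0 addn1.
  + lia.
  + move=> psi [|c0 v] /= sv; try lia.
    by case: h {H}; case: c0 {sv} => [] ; crossing_sums.
Qed.

Lemma signed_power_kink h : signed_power A (- weight h ^+ 3).
Proof.
apply: signed_powerN; case: h; rewrite /weight; first exact: (signed_powerX _ 3).
by rewrite exprVn; apply: (signed_powerX _ (- 3)).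
Qed.

Lemma reidemeister_eval x y : reidemeister x y ->
  exists2 c, signed_power A c & forall n m phi w,
    strands n x = Some m -> size w = m -> eval x phi w = c * eval y phi w.
Proof.
case=> [i h|i h|i h|i a b c abc].
- exists (- weight (~~ h) ^+ 3); first exact: signed_power_kink.
  move=> n m phi w H sw; have le : (i.+2 <= size w)%N by rewrite sw; strands_arith.
  apply: (@eval_local i [:: (Open, 0); (Cross h, 0)]%N [:: (Open, 0)]%N).
  + by rewrite /shift /= addn0.
  + by rewrite /shift /= addn0.
  + lia.
  + move=> psi [|c0 [|c1 v]] /= sv; try lia.
    by case: h {H}; case: c0 c1 {sv} => [] []; crossing_sums.
- exists (- weight (~~ h) ^+ 3); first exact: signed_power_kink.
  move=> n m phi w H sw; have le : (i <= size w)%N by rewrite sw; strands_arith.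
  apply: (@eval_local i [:: (Cross h, 0); (Close, 0)]%N [:: (Close, 0)]%N).
  + by rewrite /shift /= addn0.
  + by rewrite /shift /= addn0.
  + lia.
  + by move=> psi v sv; case: h {H}; crossing_sums.
- exists 1; first exact: signed_power1.
  move=> n m phi w H sw; have le : (i.+2 <= size w)%N by rewrite sw; strands_arith.
  apply: (@eval_local i [:: (Cross h, 0); (Cross (~~ h), 0)]%N [::]).
  + by rewrite /shift /= addn0.
  + by [].
  + lia.
  + move=> psi [|c0 [|c1 v]] /= sv; try lia.
    by case: h {H}; case: c0 c1 {sv} => [] []; crossing_sums.
- exists 1; first exact: signed_power1.
  move=> n m phi w H sw; have le : (i.+3 <= size w)%N by rewrite sw; strands_arith.
  apply: (@eval_local i [:: (Cross a, 0); (Cross b, 1); (Cross c, 0)]%N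
                        [:: (Cross c, 1); (Cross b, 0); (Cross a, 1)]%N).
  + by rewrite /shift /= addn0 addn1.
  + by rewrite /shift /= addn0 addn1.
  + lia.
  + move=> psi [|c0 [|c1 [|c2 v]]] /= sv; try lia.
    case: a b c abc {H} => [] [] [] // _; case: c0 c1 c2 {sv} => [] [] [];
    crossing_sums.
Qed.

Definition bracket (d : diagram) : F := eval d (fun w => (w == [::])%:R) [::].

Lemma strands_cat n d e :
  strands n (d ++ e) = if strands n d is Some m then strands m e else None.
Proof. by elim: d n => //= - [k i] d IH n; case: ifP. Qed.

Lemma move_bracket d e :
  closed_diagram d -> closed_diagram e -> move d e ->
  exists2 c, signed_power A c & bracket d = c * bracket e.
Proof.
rewrite /closed_diagram => cd ce [u [v [x [y [Ed Ee H]]]]].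
move: cd ce; rewrite Ed Ee !strands_cat; case: (strands 0 u) => // n.
rewrite !strands_cat.
case Ex: (strands n x) => [m|//]; case Ey: (strands n y) => [m'|//] Ev Ev'.
have [c cu [mm E]] : exists2 c, signed_power A c &
    m = m' /\ forall phi w, size w = m -> eval x phi w = c * eval y phi w.
  case: H => [H|[H|[H|H]]].
  - have mm := planar_strands H Ex Ey; exists 1; first exact: signed_power1.
    by split=> // phi w; apply: planar_eval Ex.
  - have mm := planar_strands H Ey Ex; exists 1; first exact: signed_power1.
    split=> // phi w sw; rewrite (planar_eval _ H Ey) ?mul1r //; lia.
  - have mm := reidemeister_strands H Ex Ey.
    have [c cu E] := reidemeister_eval H; exists c => //.
    by split=> // phi w; apply: E Ex.
  - have mm := reidemeister_strands H Ey Ex.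
    have [c cu E] := reidemeister_eval H; exists c^-1; first exact: signed_powerV.
    split=> // phi w sw; rewrite (E _ _ _ _ Ey); last lia.
    by rewrite mulKf // (signed_power_neq0 A0 cu).
exists c => //; rewrite /bracket !eval_cat.
by apply: (eval_ext _ Ev) => // w; apply: E.
Qed.

Lemma same_link_bracket d e : same_link d e ->
  exists2 c, signed_power A c & bracket d = c * bracket e.
Proof.
elim=> [{}d {}e [cd ce m]|{}d|{}d e1 {}e _ [c cu ->] _ [c' cu' ->]].
- exact: move_bracket.
- by exists 1; rewrite ?mul1r //; apply: signed_power1.
- by exists (c * c'); rewrite ?mulrA //; apply: signed_powerM.
Qed.

End Bracket.

(** * The bracket of a trigonal diagram *)

Section TrigonalBracket.
Local Open Scope ring_scope.
Variables (F : fieldType) (A : F).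
Hypothesis A0 : A != 0.
Local Notation weight := (weight A).

(** Coordinates in the basis formed by the two planar diagrams, indexed by the
    position of the left cap. *)
Definition vec := bool -> F.

Definition act (l : letter) (v : vec) : vec := fun k =>
  if k == l.2 then weight (~~ l.1) * v (~~ k) - weight (~~ l.1) ^+ 3 * v k
  else weight l.1 * v k.

Definition act_word (w : word) (v : vec) : vec := foldl (fun v l => act l v) v w.

Lemma act_word_cat u w v : act_word (u ++ w) v = act_word w (act_word u v).
Proof. exact: foldl_cat. Qed.

Definition loop : F := - A ^+ 2 - A^-1 ^+ 2.

Definition pairing (j : bool) (v : vec) : F := loop * v j + v (~~ j).

Definition unit_vec (i : bool) : vec := fun k => (k == i)%:R.

Definition trigonal_bracket i w j := pairing j (act_word w (unit_vec i)).

(** The vectors of the basis, with the strand that joins the two ends. *)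
Definition two_arcs (i : bool) : state F :=
  piece_op A i Open (piece_op A 0 Open (fun w => (w == [::])%:R)).

Definition plane (v : vec) : state F := fun w =>
  v false * two_arcs false w + v true * two_arcs true w.

Lemma plane_act (l : letter) v w : size w = 4%N ->
  piece_op A l.2 (Cross l.1) (plane v) w = plane (act l v) w.
Proof.
case: w => [|c0 [|c1 [|c2 [|c3 [|//]]]]] // _; case: l => h k.
rewrite /plane /two_arcs /act.
case: h; case: k; case: c0 c1 c2 c3 => [] [] [] [];
  rewrite /= /close_op /= /cup /weight /= ?mul0r ?mulr0 ?addr0 ?add0r //;
  field; rewrite ?A0 //.
Qed.

Lemma strands_crossings w : strands 4 (map crossing_piece w) = Some 4%N.
Proof. by elim: w => //= [[h []] w] IH. Qed.

Lemma eval_crossings w v u : size u = 4%N ->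
  eval A (map crossing_piece w) (plane v) u = plane (act_word w v) u.
Proof.
elim: w v => //= l w IH v su; rewrite -IH // -[RHS]mul1r.
apply: (eval_ext A0 _ (strands_crossings w)) su => u' su'.
by rewrite mul1r; apply: plane_act.
Qed.

Lemma bracket_join_ends i w j :
  bracket A (join_ends (trig i w j)) = loop * trigonal_bracket i w j.
Proof.
rewrite /bracket /join_ends /trig /= -catA eval_cat.
have -> : piece_op A i Open (piece_op A 0 Open (fun w => (w == [::])%:R)) = plane (unit_vec i).
  apply: functional_extensionality => u; rewrite /plane /unit_vec.
  by case: i => /=; rewrite ?eqxx ?mul0r ?mul1r ?addr0 ?add0r.
have E := eval_crossings w (unit_vec i); move: E.
rewrite /trigonal_bracket /pairing /loop.
set psi := eval A _ (plane _); set v := act_word _ _ => E.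
case: j; rewrite /= /close_op !E // /plane /two_arcs /=;
  rewrite /= /close_op /= /cup /weight /= ?mul0r ?mulr0 ?addr0 ?add0r //;
  field; rewrite ?A0 //.
Qed.

(** [flip] and [turned] describe the half-turn about the horizontal axis, on
    words and on coordinates. *)
Definition flip (w : word) : word := [seq (l.1, ~~ l.2) | l <- w].
Definition turned (v : vec) : vec := fun k => v (~~ k).

Lemma act_turned l v : act l (turned v) = turned (act (l.1, ~~ l.2) v).
Proof.
apply: functional_extensionality => k; rewrite /turned /act /=.
by case: l k => h [] [].
Qed.

Lemma act_word_turned w v : act_word w (turned v) = turned (act_word (flip w) v).
Proof. by elim: w v => //= l w IH v; rewrite act_turned IH. Qed.

Lemma pairing_turned j v : pairing j (turned v) = pairing (~~ j) v.
Proof. by rewrite /pairing /turned negbK. Qed.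

Definition scaled (c : F) (v : vec) : vec := fun k => c * v k.

Lemma act_scaled l c v : act l (scaled c v) = scaled c (act l v).
Proof.
by apply: functional_extensionality => k; rewrite /act /scaled; case: eqP => _; ring.
Qed.

Lemma act_word_scaled w c v : act_word w (scaled c v) = scaled c (act_word w v).
Proof. by elim: w v => //= l w IH v; rewrite act_scaled IH. Qed.

Lemma pairing_scaled j c v : pairing j (scaled c v) = c * pairing j v.
Proof. by rewrite /pairing /scaled; ring. Qed.

(** With [s], [t] the generators of one handedness and [T] the inverse of [t],
    [s t] is [T] followed by the half-turn [t s t], and the half-turn exchanges
    the two basis vectors up to a unit. *)
Lemma act_change s v :
  act (swapped s) (act s v) =
  scaled (- weight (~~ s.1) ^+ 3) (turned (act (partner s) v)).
Proof.
apply: functional_extensionality => k; rewrite /act /scaled /turned /swapped /partner.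
by case: s k => [] [] [] [] /=; rewrite /weight /=; field; rewrite ?A0.
Qed.

Lemma pairing_change s Z j v :
  pairing j (act_word (s :: swapped s :: Z) v) =
  - weight (~~ s.1) ^+ 3 * pairing (~~ j) (act_word (partner s :: flip Z) v).
Proof.
rewrite /= act_change act_word_scaled pairing_scaled act_word_turned pairing_turned.
done.
Qed.

End TrigonalBracket.

(** * Replacing sign changes *)

Lemma unisigned_cons e l w : unisigned e (l :: w) = (csign l == e) && unisigned e w.
Proof. by []. Qed.

Lemma unisigned_flip e w : unisigned e (flip w) = unisigned (~~ e) w.
Proof.
rewrite /unisigned all_map; apply: eq_all => l /=.
by rewrite /csign /=; case: l e => [[] []] [].
Qed.

Lemma csign_swapped s : csign (swapped s) = ~~ csign s.
Proof. by rewrite /csign addbN. Qed.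

Lemma csign_partner s : csign (partner s) = csign s.
Proof. by case: s => [[] []]. Qed.

Lemma csign_change s l : csign l != csign s -> l <> inverse s -> l = swapped s.
Proof. by case: s l => [[] []] [[] []]. Qed.

Lemma tight_cat u w : tight (u ++ w) -> tight w.
Proof.
move=> [nc nd]; split=> v s Z Ew; [apply: (nc (u ++ v) s Z)|apply: (nd (u ++ v) s Z)];
  by rewrite -catA -Ew.
Qed.

Lemma tight_change s l w :
  tight (s :: swapped s :: l :: w) -> csign l = ~~ csign s.
Proof.
move=> [nc nd]; have [E|] := eqVneq (csign l) (csign s); last by case: (csign l) (csign s) => [] [].
case/orP: (unisigned_letter E erefl) => /eqP El.
  by case: (nd [::] s w); rewrite El.
by case: (nc [:: s] (swapped s) w); rewrite El.
Qed.

(** What [irreducible_right] says of the last sign change: its second letter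
    occurs again, and not only at the end of the word. *)
Definition ends_late (w : word) := forall X s Z e,
  w = X ++ s :: swapped s :: Z -> unisigned e (swapped s :: Z) ->
  exists Z0 z, Z = rcons Z0 z /\ swapped s \in Z0.

Lemma ends_late_cat u w : ends_late (u ++ w) -> ends_late w.
Proof.
by move=> el X s Z e Ew; apply: (el (u ++ X)); rewrite -catA -Ew.
Qed.

Section Straighten.
Local Open Scope ring_scope.
Variable F : fieldType.

Lemma pairing_flip (A : F) j w v :
  pairing A (~~ j) (act_word A (flip w) v) = pairing A j (act_word A w (turned v)).
Proof. by rewrite -pairing_turned -act_word_turned. Qed.

(** Sign changes are removed from right to left.  If there was one, then both
    letters of the resulting sign occur before the last letter.  When the first
    letter [l] carries the change, these are the new letter [partner l] and the
    flipped image of [swapped l], which is available either because the rest of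
    the word alternates and ends late, or by induction.  So the constraint on
    the last sign change is inherited by the preceding ones. *)
Lemma straighten l Z j :
  tight (l :: Z) -> ends_late (l :: Z) -> (last l Z).2 = ~~ j ->
  exists u z,
  [/\ unisigned (csign l) (rcons u z),
      forall A : F, A != 0 -> exists2 c, signed_power A c &
        forall v, pairing A j (act_word A (l :: Z) v) =
                  c * pairing A (~~ z.2) (act_word A (rcons u z) v),
      unisigned (csign l) Z -> rcons u z = l :: Z &
      ~~ unisigned (csign l) Z -> forall m, csign m = csign l -> m \in u].
Proof.
move: {2}(size Z).+1 (ltnSn (size Z)) => n.
elim: n => // n IH in l Z j *; case: Z => [|l' Z] /= lt_n tg el jl.
  exists [::], l; split=> //; first by rewrite /unisigned /= eqxx.
  move=> A A0; exists 1; first exact: signed_power1.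
  by move=> v; rewrite mul1r jl negbK.
have [E|ne] := eqVneq (csign l') (csign l).
  have [|||u [z [uz Euz au nau]]] := IH l' Z j _ _ _ jl => //.
  - exact: (@tight_cat [:: l]).
  - exact: (@ends_late_cat [:: l]).
  exists (l :: u), z; rewrite E in uz au nau; split=> //.
  - by rewrite /= eqxx.
  - by move=> A /Euz[c cu Ec]; exists c => // v; rewrite -Ec.
  - by rewrite /= => /au->.
  - by rewrite /= => H m ml; rewrite inE nau ?orbT.
have El' : l' = swapped l.
  by apply: csign_change => // E; case: tg => + _ => /(_ [::] l Z); rewrite E.
subst l'; case: Z => [|l' Z] in lt_n tg el jl *.
  have [|z [z' []]] := el [::] l [::] (~~ csign l) erefl; last by case: z.
  by rewrite unisigned_cons csign_swapped eqxx.
have sl' := tight_change tg.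
have [||||u [z [uz Euz au nau]]] := IH l' Z j => //.
- move: lt_n => /=; lia.
- exact: (@tight_cat [:: l; swapped l]).
- exact: (@ends_late_cat [:: l; swapped l]).
exists (partner l :: flip u), (z.1, ~~ z.2).
have Efl : rcons (flip u) (z.1, ~~ z.2) = flip (rcons u z) by rewrite /flip map_rcons.
split.
- by rewrite rcons_cons unisigned_cons csign_partner eqxx Efl unisigned_flip -sl'.
- move=> A A0; have [c cu Ec] := Euz A A0; exists (- weight A (~~ l.1) ^+ 3 * c).
    by apply: signed_powerM => //; apply: signed_power_kink.
  move=> v; apply: etrans (pairing_change A0 l (l' :: Z) j v) _.
  rewrite -mulrA rcons_cons Efl; congr (_ * _).
  apply: etrans (pairing_flip A j (l' :: Z) (act A (partner l) v)) _.
  by rewrite Ec; congr (_ * _); symmetry; apply: pairing_flip.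
- by [].
move=> _ m ml; rewrite inE; case/orP: (unisigned_letter ml erefl) => /eqP ->.
  have -> : l = ((swapped l).1, ~~ (swapped l).2) by rewrite negbK; case: (l).
  rewrite orbC (map_f (fun l : letter => (l.1, ~~ l.2))) //.
  have [H|/nau] := boolP (unisigned (csign l') Z); last first.
    by apply; rewrite csign_swapped.
  have [|Z0 [z0 [E0 H0]]] := el [::] l (l' :: Z) (~~ csign l) erefl.
    by rewrite !unisigned_cons csign_swapped sl' eqxx -sl'.
  by move: E0 H0; rewrite -(au H) => /rcons_inj[<- _].
by rewrite eqxx.
Qed.

Lemma first_change e l w : csign l = e -> tight (l :: w) -> ~~ unisigned e w ->
  exists X s Z, l :: w = X ++ s :: swapped s :: Z /\ unisigned e (rcons X s).
Proof.
elim: w => //= l' w IH in l *; move=> el tg; have [E|ne] := eqVneq (csign l') e.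
  move=> /= nu; have [|X [s [Z [EX uX]]]] := IH l' E _ nu.
    exact: (@tight_cat [:: l]).
  by exists (l :: X), s, Z; rewrite EX /= el eqxx.
move=> _; exists [::], l, w; rewrite /= el eqxx; split=> //; congr (_ :: _ :: _).
apply: csign_change; rewrite ?el // => E.
by case: tg => + _ => /(_ [::] l w); rewrite E.
Qed.

(** The interior [I] of the alternating word has three blocks at least: [s] on
    both sides of the letter that replaces the first sign change. *)
Lemma irreducible_straighten i w j : irreducible i w j ->
  (exists e, unisigned e w) \/
  exists e x I y s I1 I2,
  [/\ unisigned e (x :: rcons I y), x.2 = ~~ i,
      forall A : F, A != 0 -> exists2 c, signed_power A c &
        trigonal_bracket A i w j =
          c * trigonal_bracket A i (x :: rcons I y) (~~ y.2) &
      [/\ I = I1 ++ partner s :: I2, s \in I1 & s \in I2]].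
Proof.
case: w => [|l w] irr; first by left; exists true.
have [u|nu] := boolP (unisigned (csign l) w).
  by left; exists (csign l); rewrite /= eqxx.
right; have tg := irreducible_tight irr.
have [X [s [Z [EX uX]]]] := first_change erefl tg nu.
exists (csign l); move: (csign l) uX => e uX {nu}; rewrite {l w}EX in irr tg *.
have el : ends_late (X ++ s :: swapped s :: Z).
  by move=> X' s' Z' e' E; move: irr; rewrite E; apply: irreducible_right.
have [x [I1 [EX sI1]]] := irreducible_left irr uX.
have es : csign s = e by apply/eqP; move: uX; rewrite /unisigned all_rcons => /andP[].
case: Z => [|l Z] in irr tg el *.
  have [|z [z' []]] := el _ s [::] (~~ csign s) erefl; last by case: z.
  by rewrite unisigned_cons csign_swapped eqxx.
have sl : csign l = ~~ csign s by apply: (@tight_change s l Z); apply: tight_cat tg.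
have [|||u [z [uz Euz au nau]]] := @straighten l Z j.
- by apply: (@tight_cat (X ++ [:: s; swapped s])); rewrite -catA.
- by apply: (@ends_late_cat (X ++ [:: s; swapped s])); rewrite -catA.
- apply: (@irreducible_last i _ (X ++ s :: swapped s :: belast l Z)).
  by rewrite rcons_cat /= -lastI.
have Efl : rcons (flip u) (z.1, ~~ z.2) = flip (rcons u z) by rewrite /flip map_rcons.
exists x, (I1 ++ partner s :: flip u), (z.1, ~~ z.2).
exists s, I1, (flip u); split.
- rewrite rcons_cat rcons_cons Efl -cat_cons -EX.
  rewrite /unisigned all_cat -/(unisigned _ _) -/(unisigned _ _).
  rewrite unisigned_cons csign_partner es eqxx unisigned_flip -es -sl uz andbT.
  by rewrite andbT; move: uX; rewrite /unisigned all_rcons es => /andP[].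
- by move: irr; rewrite EX => /irreducible_head.
- move=> A A0; have [c cu Ec] := Euz A A0; exists (- weight A (~~ s.1) ^+ 3 * c).
    by apply: signed_powerM => //; apply: signed_power_kink.
  rewrite /trigonal_bracket rcons_cat rcons_cons Efl -cat_cons -EX.
  rewrite !act_word_cat; set v := act_word _ X _.
  apply: etrans (pairing_change A0 s (l :: Z) j v) _; rewrite -mulrA; congr (_ * _).
  apply: etrans (pairing_flip A j (l :: Z) (act A (partner s) v)) _.
  by rewrite Ec; congr (_ * _); symmetry; apply: pairing_flip.
- split=> //; have -> : s = ((swapped s).1, ~~ (swapped s).2) by rewrite negbK; case: (s).
  apply: (map_f (fun l : letter => (l.1, ~~ l.2))).
  have [H|/nau] := boolP (unisigned (csign l) Z); last first.
    by apply; rewrite csign_swapped.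
  have [|Z0 [z0 [E0 H0]]] := el X s (l :: Z) (~~ csign s) erefl.
    by rewrite !unisigned_cons csign_swapped sl eqxx -sl.
  by move: E0 H0; rewrite -(au H) => /rcons_inj[<- _].
Qed.

End Straighten.

(** * Polynomials of alternating words *)

(** The number of blocks of [true], read from left to right; the flag says that
    the next [true] begins a new block. *)
Definition count_step (q : bool) (s : bool * nat) : bool * nat :=
  if q then (false, s.2 + s.1) else (true, s.2).
Definition count_blocks (s : bool * nat) (W : seq bool) :=
  foldl (fun s q => count_step q s) s W.

Lemma count_blocks_cat s U V :
  count_blocks s (U ++ V) = count_blocks (count_blocks s U) V.
Proof. exact: foldl_cat. Qed.

(** Twice the count plus the flag never decreases, which makes the count easy
    to bound from below without describing the blocks. *)
Lemma count_blocks_mono (s : bool * nat) W :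
  s.2.*2 + s.1 <= (count_blocks s W).2.*2 + (count_blocks s W).1.
Proof.
elim: W s => //= q W IH s; apply: leq_trans (IH _).
by rewrite /count_step; case: q; case: s => [[] b] /=; lia.
Qed.

Lemma count_blocks_true b W : true \in W -> b < (count_blocks (true, b) W).2.
Proof.
move=> /splitPr[U V]; rewrite count_blocks_cat /=.
have := count_blocks_mono (true, b) U; move: (count_blocks _ U) => [a c] /= H.
have := count_blocks_mono (count_step true (a, c)) V; rewrite /count_step /=.
move: (count_blocks _ V) => [a' c'] /=; case: a H; case: a'; lia.
Qed.

Lemma count_blocks_two U V : true \in U -> true \in V ->
  1 < (count_blocks (true, 0) (U ++ false :: V)).2.
Proof.
move=> /(count_blocks_true 0) + H; rewrite count_blocks_cat /=.
case: (count_blocks _ U) => a b /= b0; rewrite /count_step /=.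
exact: leq_ltn_trans (count_blocks_true b H).
Qed.

Lemma count_blocks_nseq q m s :
  count_blocks s (nseq m q) = if m is 0 then s else count_step q s.
Proof.
elim: m s => //= m IH s; rewrite IH; case: m {IH} => //= _.
by rewrite /count_step; case: q => //=; rewrite addn0.
Qed.

Lemma count_two_blocks q m n :
  (count_blocks (true, 0) (nseq m q ++ nseq n (~~ q))).2 <= 1.
Proof.
rewrite count_blocks_cat !count_blocks_nseq.
by case: q m n => [] [|m] [|n].
Qed.

Local Open Scope ring_scope.

(** The variable [q] of the deformed continued fractions.  It is [- A ^ (-4)] or
    [- A ^ 4], since [A] will be the inverse of ['X], or ['X]; see [param]. *)
Definition x4 : {poly int} := - 'X^4.

Definition poly_step (q : bool) (p : {poly int} * {poly int}) :=
  if q then (x4 * p.1, x4 * p.1 + p.2) else (x4 * p.1 + p.2, p.2).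
Definition poly_run (W : seq bool) := foldl (fun p q => poly_step q p) (1, 1) W.
(** The last letter contributes, up to a unit, the same covector [(q ^ 2, 1)]
    whichever of the two generators it is. *)
Definition interior_poly (W : seq bool) : {poly int} :=
  (poly_run W).2 + x4 ^+ 2 * (poly_run W).1.

Lemma coef_x4M (p : {poly int}) i : (x4 * p)`_i = if (i < 4)%N then 0 else - p`_(i - 4).
Proof. by rewrite mulNr coefN coefXnM; case: ifP; rewrite ?oppr0. Qed.

Lemma coef_poly_run W :
  let s := count_blocks (true, 0%N) W in
  [/\ (poly_run W).2`_0 = 1, (poly_run W).1`_0 = s.1%:R &
      (poly_run W).2`_4 = - s.2%:R].
Proof.
elim/last_ind: W => [|W q]; first by rewrite /= coef1 coef1.
rewrite -cats1 count_blocks_cat /poly_run foldl_cat -/(poly_run W) /=.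
case: (poly_run W) => a b; case: (count_blocks _ W) => c n /= [b0 a0 b4].
rewrite /poly_step /count_step; case: q; rewrite /= !coefD !coef_x4M /= ?add0r ?b0 ?b4.
  by split=> //; rewrite subnn a0 natrD opprD addrC.
by [].
Qed.

Lemma interior_poly0 W : (interior_poly W)`_0 = 1.
Proof. by rewrite coefD expr2 -mulrA coef_x4M; case: (coef_poly_run W) => -> _ _. Qed.

Lemma interior_poly4 W : (interior_poly W)`_4 = - (count_blocks (true, 0%N) W).2%:R.
Proof.
rewrite coefD expr2 -mulrA !coef_x4M /= oppr0 addr0.
by case: (coef_poly_run W).
Qed.

(** The field is only required to contain the polynomials faithfully; it is
    the field of rational functions at the end. *)
Section Embedding.
Variables (F : fieldType) (emb : {rmorphism {poly int} -> F}).
Hypothesis emb_inj : injective emb.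
Local Notation "p %:F" := (emb p).
Local Notation t := (emb 'X).

Lemma t_neq0 : t != 0.
Proof. by rewrite -(rmorph0 emb) (inj_eq emb_inj) polyX_eq0. Qed.

(** The choice of [A] for which it is the letters of handedness [c] whose blocks
    are counted. *)
Definition param (c : bool) : F := if c then t else t^-1.

Lemma param_neq0 c : param c != 0.
Proof. by case: c; rewrite /param ?invr_eq0 t_neq0. Qed.

Lemma signed_power_param c x : signed_power (param c) x -> signed_power t x.
Proof. by case: c => // /signed_power_inv. Qed.

Lemma emb_x4 : x4%:F = - t ^+ 4 :> F.
Proof. by rewrite rmorphN rmorphXn. Qed.

(** The basis is rescaled so that both generators act by polynomial matrices, up
    to units. *)
Definition coords (k : bool) (p : {poly int} * {poly int}) : vec F :=
  fun m => if m == k then p.1%:F else t^-1 ^+ 2 * p.2%:F.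

Definition step_unit (q : bool) : F := if q then - t^-1 ^+ 3 else t^-1.

Lemma signed_power_step q : signed_power t (step_unit q).
Proof.
case: q; rewrite /step_unit; last exact: (signed_powerX _ (- 1)).
by apply: signed_powerN; rewrite exprVn; apply: (signed_powerX _ (- 3)).
Qed.

Lemma act_coords c e l p : csign l = e ->
  act (param c) l (coords (~~ c (+) e) p) =
  scaled (step_unit (l.1 == c)) (coords (~~ c (+) e) (poly_step (l.1 == c) p)).
Proof.
move=> <-; apply: functional_extensionality => k.
rewrite /act /scaled /coords /poly_step /step_unit /weight /csign /param.
have t0 := t_neq0.
case: l k c => [[] []] [] [];
  rewrite /= ?rmorphD ?rmorphM ?emb_x4; move: (p.1%:F) (p.2%:F) => a b;
  by field; rewrite ?t0 ?oner_neq0 //.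
Qed.

(** The first letter also gives the same vector [(1, 1)] in both cases. *)
Lemma act_arc c e l : csign l = e ->
  act (param c) l (unit_vec F (~~ l.2)) = scaled t (coords (~~ c (+) e) (1, 1)).
Proof.
move=> <-; apply: functional_extensionality => k.
rewrite /act /scaled /coords /unit_vec /weight /csign /param.
have t0 := t_neq0.
by case: l k c => [[] []] [] []; rewrite /= ?rmorph1; field; rewrite ?t0 ?oner_neq0 //.
Qed.

Lemma pairing_coords c e l p : csign l = e ->
  pairing (param c) (~~ l.2) (act (param c) l (coords (~~ c (+) e) p)) =
  - t^-1 ^+ 5 * (p.2 + x4 ^+ 2 * p.1)%:F.
Proof.
move=> <-; rewrite /pairing /loop /act /coords /weight /csign /param.
have t0 := t_neq0.
case: l c => [[] []] [];
  rewrite /= ?rmorphD ?rmorphM ?rmorphXn /= ?emb_x4; move: (p.1%:F) (p.2%:F) => a b;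
  by field; rewrite ?t0 ?oner_neq0 //.
Qed.

Lemma act_word_coords c e I p : unisigned e I ->
  exists2 u, signed_power t u &
  act_word (param c) I (coords (~~ c (+) e) p) =
  scaled u (coords (~~ c (+) e)
    (foldl (fun p q => poly_step q p) p [seq l.1 == c | l <- I])).
Proof.
elim: I p => [|l I IH] p /=.
  exists 1; first exact: signed_power1.
  by apply: functional_extensionality => k; rewrite /scaled mul1r.
move=> /andP[/eqP el /IH eI].
have [u uu Eu] := eI (poly_step (l.1 == c) p).
exists (step_unit (l.1 == c) * u); first by apply: signed_powerM (signed_power_step _) uu; apply: t_neq0.
rewrite (act_coords _ _ el) act_word_scaled Eu.
by apply: functional_extensionality => k; rewrite /scaled mulrA.
Qed.

Lemma alternating_bracket c e i x I y :
  unisigned e (x :: rcons I y) -> x.2 = ~~ i ->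
  exists2 u, signed_power t u &
  trigonal_bracket (param c) i (x :: rcons I y) (~~ y.2) =
  u * (interior_poly [seq l.1 == c | l <- I])%:F.
Proof.
rewrite unisigned_cons /unisigned all_rcons => /and3P[/eqP ex /eqP ey eI] xi.
have [u uu Eu] := act_word_coords c (1, 1) eI.
exists (t * u * - t^-1 ^+ 5).
  have t0 := t_neq0.
  apply: signed_powerM => //; first by apply: signed_powerM => //; apply: (signed_powerX _ 1).
  by apply: signed_powerN; rewrite exprVn; apply: (signed_powerX _ (- 5)).
rewrite /trigonal_bracket -cats1 -cat1s !act_word_cat /=.
have -> : i = ~~ x.2 by rewrite xi negbK.
rewrite (act_arc _ ex) act_word_scaled Eu !act_scaled !pairing_scaled (pairing_coords _ _ ey).
by rewrite !mulrA.
Qed.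

(** The constant coefficients determine the unit. *)
Lemma signed_power_poly_eq (f g : {poly int}) u :
  signed_power t u -> f`_0 = 1 -> g`_0 = 1 -> f%:F = u * g%:F -> f = g.
Proof.
move=> [b [k ->]] f0 g0.
have sb : (-1) ^+ b = ((-1) ^+ b : {poly int})%:F :> F by rewrite rmorphXn rmorphN1.
case: k => n E.
  have {}E : f = (-1) ^+ b * g * 'X^n.
    by apply: emb_inj; rewrite E !rmorphM /= -sb rmorphXn /= mulrAC.
  have := congr1 (fun p : {poly int} => p`_0) E.
  rewrite f0 -mulrA -(rmorph_sign (polyC : {rmorphism int -> {poly int}})) coefCM coefMXn g0.
  case: n E => [|n] E; last by rewrite mulr0.
  by rewrite E; case: b {sb E} => //= _; rewrite expr0 mul1r expr0 mulr1.
have {}E : f * 'X^(n.+1) = (-1) ^+ b * g.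
  apply: emb_inj; rewrite !rmorphM /= E -sb rmorphXn /= NegzE -exprnN mulrAC.
  by rewrite divfK // expf_neq0 // t_neq0.
have := congr1 (fun p : {poly int} => p`_0) E.
by rewrite coefMXn /= -(rmorph_sign (polyC : {rmorphism int -> {poly int}})) coefCM g0 mulr1; case: b {sb E}.
Qed.

(** * Brackets of the normal forms *)

Lemma Dtrig1 b (m : int) :
  Dtrig b [:: m] = trig (~~ b) (nseq `|m|%N (0 < m, b)) (~~ b).
Proof. by rewrite /Dtrig /trig /= map_nseq cats0; case: b. Qed.

Lemma Dtrig2 b (m n : int) : Dtrig b [:: m; n] =
  trig (~~ b) (nseq `|m|%N (0 < m, b) ++ nseq `|n|%N (n < 0, ~~ b)) b.
Proof. by rewrite /Dtrig /trig /= map_cat !map_nseq cats0; case: b. Qed.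

(** The coefficient at ['X ^ 4 = - q] is minus the number of blocks. *)
Definition few_blocks (f : {poly int}) := f`_0 = 1 /\ -1 <= f`_4.

Lemma few_blocks_two q m n : few_blocks (interior_poly (nseq m q ++ nseq n (~~ q))).
Proof.
split; first exact: interior_poly0.
by rewrite interior_poly4 lerN2 -[1]/(1%:R) ler_nat count_two_blocks.
Qed.

(** The words of length 0 and 1 have no interior and are computed directly. *)
Lemma one_twist_bracket c b (m : int) : exists u f,
  [/\ signed_power t u, few_blocks f &
    bracket (param c) (join_ends (Dtrig b [:: m])) = loop (param c) * (u * f%:F)].
Proof.
have t0 := t_neq0; rewrite Dtrig1 bracket_join_ends ?param_neq0 //.
case: `|m|%N => [|[|k]].
- exists (- t^-1 ^+ 2), (1 + 'X^4); split.
  + by apply: signed_powerN; rewrite exprVn; apply: (signed_powerX _ (- 2)).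
  + by split; rewrite coefD coef1 coefXn.
  congr (_ * _); rewrite /trigonal_bracket /pairing /loop /unit_vec /param rmorphD rmorph1 rmorphXn /=.
  by case: b c => [] [] /=; field; rewrite ?t0 ?oner_neq0 //.
- exists (if (0 < m) == c then - t ^+ 3 else - t^-1 ^+ 3), 1; split.
  + case: ifP => _; apply: signed_powerN; first exact: (signed_powerX _ 3).
    by rewrite exprVn; apply: (signed_powerX _ (- 3)).
  + by split; rewrite coef1.
  congr (_ * _); rewrite /trigonal_bracket /pairing /loop /= /act /unit_vec /param rmorph1.
  case: b c (0 < m) => [] [] [] /=; rewrite /weight; by field; rewrite ?t0 ?oner_neq0.
- set l := (_, b).
have [||u uu Eu] := @alternating_bracket c (csign l) (~~ b) l (nseq k l) l.
- by rewrite /unisigned /= all_rcons eqxx /= all_nseq eqxx orbT.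
- by rewrite negbK.
exists u, (interior_poly [seq l.1 == c | l <- nseq k l]); split=> //.
  by rewrite map_nseq -[nseq _ _]cats0; apply: (few_blocks_two _ k 0).
by rewrite -Eu -cats1 -[[:: l]]/(nseq 1 l) -nseqD addn1.
Qed.

Lemma loop_neq0 c : loop (param c) != 0.
Proof.
have t0 := t_neq0.
have -> : loop (param c) = - t^-1 ^+ 2 * (1 + 'X^4)%:F.
  rewrite /loop /param rmorphD rmorph1 rmorphXn /=.
  by case: c => /=; field; rewrite ?t0 ?oner_neq0.
rewrite mulf_neq0 ?oppr_eq0 ?expf_neq0 ?invr_eq0 // -(rmorph0 emb) (inj_eq emb_inj).
apply/eqP => /(congr1 (fun p : {poly int} => p`_0)).
by rewrite coefD coef1 coefXn coef0.
Qed.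

Lemma two_twist_bracket c b (m n : int) : 0 < m * n -> exists u f,
  [/\ signed_power t u, few_blocks f &
    bracket (param c) (join_ends (Dtrig b [:: m; n])) = loop (param c) * (u * f%:F)].
Proof.
move=> mn; rewrite Dtrig2 bracket_join_ends ?param_neq0 //.
have n0 : (n < 0) = ~~ (0 < m).
  move: mn; case: (ltrgt0P m) => [m0|m0|->]; last by rewrite mul0r ltxx.
    by rewrite pmulr_rgt0 // => /ltW; rewrite leNgt => /negPf.
  by rewrite nmulr_rgt0.
have : n != 0 by apply: contraTneq mn => ->; rewrite mulr0 ltxx.
have : m != 0 by apply: contraTneq mn => ->; rewrite mul0r ltxx.
rewrite -!absz_gt0 n0; case: `|m|%N => // p _; case: `|n|%N => // q _.
set l := (_, b); set l' := (_, ~~ b).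
have E : csign l' = csign l by rewrite /csign /= addbN addNb negbK.
have [||u uu Eu] := @alternating_bracket c (csign l) (~~ b) l (nseq p l ++ nseq q l') l'.
- by rewrite /unisigned /= all_rcons all_cat !all_nseq E !eqxx !orbT.
- by rewrite negbK.
exists u, (interior_poly [seq l.1 == c | l <- nseq p l ++ nseq q l']); split=> //.
  rewrite map_cat !map_nseq.
  have -> : (l'.1 == c) = ~~ (l.1 == c) by rewrite /=; case: (0 < m) c {mn n0 l l' E uu Eu} => [] [].
  exact: few_blocks_two.
rewrite -Eu negbK -cats1 -catA -[[:: l']]/(nseq 1 l') -nseqD addn1; congr (_ * trigonal_bracket _ _ _ _).
Qed.

(** An irreducible diagram of [C(m)] or [C(m, n)] has no sign change: otherwise
    its polynomial, which is determined by the link, would count at least two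
    blocks. *)
Lemma irreducible_unisigned (K : diagram) b m i w j :
  (exists m1, m = [:: m1]) \/ (exists m1 m2, 0 < m1 * m2 /\ m = [:: m1; m2]) ->
  same_link (join_ends (Dtrig b m)) K -> same_link (join_ends (trig i w j)) K ->
  irreducible i w j -> exists e, unisigned e w.
Proof.
move=> hm CK DK irr; have [//|] := irreducible_straighten F irr.
move=> [e [x [I [y [s [I1 [I2 [eI xi Ebr [EI s1 s2]]]]]]]]]; exfalso.
(* [A] is chosen so that the blocks of [s] are counted. *)
set c := s.1.
have A0 := param_neq0 c.
have [u uu Eu] := alternating_bracket c eI xi.
have [v uv Ev] := Ebr _ A0.
have [u2 [f [uu2 [f0 f4] Ef]]] : exists u f, [/\ signed_power t u, few_blocks f &
    bracket (param c) (join_ends (Dtrig b m)) = loop (param c) * (u * f%:F)].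
  case: hm => [[m1 ->]|[m1 [m2 [m12 ->]]]]; first exact: one_twist_bracket.
  exact: two_twist_bracket.
have [c1 uc1 E1] := same_link_bracket A0 DK.
have [c2 uc2 E2] := same_link_bracket A0 CK.
have pp := @signed_power_param c; have t0 := t_neq0.
have Efg : f = interior_poly [seq l.1 == c | l <- I].
  have uD := signed_powerM t0 (signed_powerV (pp _ uc1)) (signed_powerM t0 (pp _ uv) uu).
  have uC := signed_powerM t0 (signed_powerV uu2) (pp _ uc2).
  apply: signed_power_poly_eq (signed_powerM t0 uC uD) f0 (interior_poly0 _) _.
  apply: (mulfI (signed_power_neq0 t0 uu2)); apply: (mulfI (loop_neq0 c)).
  have EK : bracket (param c) K =
      c1^-1 * (loop (param c) * (v * (u * (interior_poly [seq l.1 == c | l <- I])%:F))).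
    by rewrite -Eu -Ev -bracket_join_ends // E1 mulKf // (signed_power_neq0 A0 uc1).
  rewrite -Ef E2 EK; have c10 := signed_power_neq0 A0 uc1.
  by field; rewrite ?c10 ?(signed_power_neq0 t0 uu2).
move: f4; rewrite Efg interior_poly4 EI map_cat /=.
have -> : (partner s).1 == c = false by rewrite /c; case: (s) => [[]].
have sc (J : word) : s \in J -> true \in [seq l.1 == c | l <- J].
  by move=> sJ; apply/mapP; exists s; rewrite ?eqxx.
by rewrite lerN2 -[1]/(1%:R) ler_nat leqNgt count_blocks_two ?sc.
Qed.

End Embedding.

(** * The theorem *)

Lemma closed_join_ends d : trigonal d -> closed_diagram (join_ends d).
Proof.
move=> /trigonalP[i [w [j ->]]]; rewrite /closed_diagram /join_ends /trig /=.
have -> : (i + 0 <= 2)%N by case: i.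
by rewrite -catA strands_cat strands_crossings; case: j.
Qed.

Lemma same_link_sym d e : same_link d e -> same_link e d.
Proof.
elim=> [{}d {}e [cd ce [u [v [x [y [Ed Ee H]]]]]]|{}d|d1 d2 d3 _ IH _ IH'].
- by apply: rt_step; split=> //; exists u, v, y, x; split=> //; tauto.
- exact: rt_refl.
- exact: rt_trans IH' IH.
Qed.

Lemma isotopy_same_link d e :
  trigonal_isotopy d e -> same_link (join_ends d) (join_ends e).
Proof.
elim=> [{}d {}e [td te [u [v [x [y [Ed Ee H]]]]] _]|{}d|{}d e1 {}e _ IH _ IH'].
- apply: rt_step; split; try exact: closed_join_ends.
  exists ((Open, 0%N) :: u), (v ++ [:: (Close, 0%N)]), x, y.
  by split=> //; rewrite /join_ends ?Ed ?Ee -!catA.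
- exact: rt_refl.
- exact: rt_trans IH IH'.
Qed.

Theorem theorem1p1 (K : diagram) (hK : closed_diagram K)
    (hC : (exists m : int, (0 <= m)%R /\ conway_normal_form K [:: m]) \/
          (exists m n : int, (0 < m * n)%R /\ conway_normal_form K [:: m; n]))
    (D : diagram) (hD : trigonal_diagram_of K D) :
  exists D' : diagram,
    [/\ trigonal D', alternating D' & trigonal_isotopy D D'].
Proof.
have [/trigonalP[i0 [w0 [j0 ED]]] DK] := hD.
have [i [w [j [r irr]]]] := red_irreducible i0 w0 j0.
exists (trig i w j); have iso := red_isotopy r; rewrite -ED in iso.
split=> //; first by apply/trigonalP; exists i, w, j.
have inj : injective (@tofrac {poly int}) by move=> p q /eqP; rewrite tofrac_eq => /eqP.
have DK' : same_link (join_ends (trig i w j)) K.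
  apply: rt_trans DK; apply: same_link_sym.
  by apply: isotopy_same_link.
suff [e ew] : exists e, unisigned e w by apply: unisigned_alternating ew.
case: hC => [[m [_ [_ [b CK]]]]|[m [n [mn [_ [b CK]]]]]].
  by apply: (irreducible_unisigned inj _ CK DK' irr); left; exists m.
by apply: (irreducible_unisigned inj _ CK DK' irr); right; exists m, n.
Qed.
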